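(* Let $n$ and $k$ be integers with $k\ge 1$ and $n\ge 2k+1$. Then the bipartite Kneser graph $H(n,k)$ is symmetric (that is, arc-transitive).
   Context: For a positive integer $n$, let $[n]=\{1,2,\dots,n\}$. For integers $k\ge 1$ and $n\ge 2k+1$, the bipartite Kneser graph $H(n,k)$ is the simple graph whose vertices are all the $k$-element subsets and all the $(n-k)$-element subsets of $[n]$, two distinct vertices $A,B$ being adjacent if and only if $A\subset B$ or $B\subset A$. A graph $\Gamma$ is symmetric (or arc-transitive) if for all vertices $u,v,x,y$ of $\Gamma$ such that $u$ and $v$ are adjacent and $x$ and $y$ are adjacent, there is an automorphism $\pi\in\mathrm{Aut}(\Gamma)$ with $\pi(u)=x$ and $\pi(v)=y$. *)

(* Defs.v *)
From mathcomp Require Import all_boot all_fingroup.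

Set Implicit Arguments.
Unset Strict Implicit.
Unset Printing Implicit Defensive.

Record sgraph := SGraph {
  vertex :> finType;
  adj : rel vertex;
  adj_sym : symmetric adj;
  adj_irrefl : irreflexive adj
}.

Definition graph_aut (G : sgraph) : {set {perm G}} :=
  [set p : {perm G} | [forall u, forall v, adj (p u) (p v) == adj u v]].

Definition arc_transitive (G : sgraph) : Prop :=
  forall u v x y : G, adj u v -> adj x y ->
    exists2 p : {perm G}, p \in graph_aut G & p u = x /\ p v = y.

(* The ground set {1, ..., n} is represented by 'I_n = {0, ..., n - 1}. *)
Definition bkneser_vertex (n k : nat) : finType :=
  {A : {set 'I_n} | (#|A| == k) || (#|A| == n - k)}.

Definition bkneser_adj (n k : nat) : rel (bkneser_vertex n k) :=
  fun A B => (A != B) && ((val A \subset val B) || (val B \subset val A)).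

Lemma bkneser_adj_sym n k : symmetric (@bkneser_adj n k).
Proof. by move=> A B; rewrite /bkneser_adj eq_sym orbC. Qed.

Lemma bkneser_adj_irrefl n k : irreflexive (@bkneser_adj n k).
Proof. by move=> A; rewrite /bkneser_adj eqxx. Qed.

Definition bipartite_kneser (n k : nat) : sgraph :=
  SGraph (@bkneser_adj_sym n k) (@bkneser_adj_irrefl n k).

(* Main.v *)
Require Import Defs.
From mathcomp Require Import all_boot all_fingroup.

Set Implicit Arguments.
Unset Strict Implicit.
Unset Printing Implicit Defensive.

(** An edge of the bipartite Kneser graph is a strict inclusion, so, as only
    the cardinals k and n - k occur, it is a flag A \subset B with #|A| = k
    and #|B| = n - k.  The symmetric group is transitive on flags with
    prescribed cardinals ([exists_perm_flag]): colour each point by its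
    membership in A and in B; two colourings with the same number of points
    of each colour differ by a permutation ([exists_perm_coloring]).

    Permutations of the points thus carry any edge to any other, but only
    with the smaller set going to the smaller one.  Complementation exchanges
    the two cardinals and reverses inclusions; composed with a permutation of
    the points, it yields the automorphisms that carry an edge to the reverse
    of another. *)

(** The two lists of colours have the same multiplicities, hence are
    rearrangements of each other, and the rearrangement acts on positions. *)
Lemma exists_perm_coloring n (C : eqType) (f g : 'I_n -> C) :
  (forall c, #|[set i | f i == c]| = #|[set i | g i == c]|) ->
  exists p : {perm 'I_n}, forall i, g (p i) = f i.
Proof.
move=> eq_fg.
have count_color (h : 'I_n -> C) c :
    count_mem c [tuple h i | i < n] = #|[set i | h i == c]|.
  by rewrite /= count_map cardE -size_filter enumT; congr size;
     apply: eq_filter => i; rewrite !inE.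
have /tuple_permP[p fgp] :
    perm_eq [tuple f i | i < n] [tuple g i | i < n].
  by apply/allP => c _; rewrite inE !count_color eq_fg.
exists p => i; have /(congr1 (fun t => tnth t i)) := val_inj fgp.
by rewrite !tnth_mktuple.
Qed.

Lemma exists_perm_flag n (A B C D : {set 'I_n}) :
  A \subset B -> C \subset D -> #|A| = #|C| -> #|B| = #|D| ->
  exists p : {perm 'I_n}, p @: A = C /\ p @: B = D.
Proof.
pose color (X Y : {set 'I_n}) i := (i \in X, i \in Y).
have colorE X Y a b : [set i | color X Y i == (a, b)] =
    (if a then X else ~: X) :&: (if b then Y else ~: Y).
  by apply/setP => i; rewrite !inE xpair_eqE; case: a; case: b;
     rewrite ?inE ?eqb_id ?eqbF_neg.
move=> sAB sCD eqAC eqBD.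
have [|p pE] := @exists_perm_coloring n _ (color A B) (color C D).
  case=> a b; rewrite !colorE; case: a; case: b.
  - by rewrite (setIidPl sAB) (setIidPl sCD).
  - by rewrite -!setDE; move: sAB sCD; rewrite -!setD_eq0 => /eqP-> /eqP->.
  - by rewrite ![~: _ :&: _]setIC -!setDE !cardsDS // eqAC eqBD.
  - by rewrite -!setCU (setUidPr sAB) (setUidPr sCD) (cardsCs (~: B)) (cardsCs (~: D)) !setCK eqBD.
have imE (X Y : {set 'I_n}) : (forall i, (p i \in Y) = (i \in X)) -> p @: X = Y.
  move=> pXY; apply/setP => j; rewrite -[j](permKV p) mem_imset ?pXY //.
  exact: perm_inj.
by exists p; split; apply: imE => i; case: (pE i).
Qed.

Lemma subset_perm_imset (T : finType) (p : {perm T}) (A B : {set T}) :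
  (p @: A \subset p @: B) = (A \subset B).
Proof.
rewrite sub_imset_pre; apply: eq_subset_r => i.
by rewrite inE mem_imset //; apply: perm_inj.
Qed.

(** Adjacency ignores the direction of the inclusion, so comparability is all
    that has to be preserved: this covers both the monotone maps induced by
    permutations of the points and their antitone composites with
    complementation. *)
Lemma bkneser_aut_lift n k (f : {set 'I_n} -> {set 'I_n}) :
  injective f ->
  (forall A : {set 'I_n}, (#|A| == k) || (#|A| == n - k) ->
     (#|f A| == k) || (#|f A| == n - k)) ->
  (forall A B : {set 'I_n}, (f A \subset f B) || (f B \subset f A)
     = (A \subset B) || (B \subset A)) ->
  exists2 q : {perm bipartite_kneser n k},
    q \in graph_aut (bipartite_kneser n k) &
    forall u, val (q u) = f (val u).
Proof.
move=> f_inj f_vtx f_cmp.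
pose F (u : bipartite_kneser n k) : bipartite_kneser n k :=
  exist _ (f (val u)) (f_vtx _ (valP u)).
have F_inj : injective F.
  by move=> u v /(congr1 val) /= /f_inj /val_inj.
exists (perm F_inj) => [|u]; last by rewrite permE.
rewrite inE; apply/forallP => u; apply/forallP => v; rewrite !permE.
by rewrite /= /bkneser_adj (inj_eq F_inj) /= f_cmp.
Qed.

(** The two vertices of an edge have distinct cardinals because the inclusion
    is strict, which leaves only one possibility as k <= n - k. *)
Lemma bkneser_adj_card n k (u v : bkneser_vertex n k) :
  k <= n - k -> bkneser_adj u v -> val u \subset val v ->
  #|val u| = k /\ #|val v| = n - k.
Proof.
move=> le_k /andP[neq_uv _] s_uv.
have : #|val u| < #|val v|.
  by apply: proper_card; rewrite properEneq s_uv andbT (inj_eq val_inj).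
case/orP: (valP u) => /eqP->; case/orP: (valP v) => /eqP-> //.
- by rewrite ltnn.
- by rewrite ltnNge le_k.
- by rewrite ltnn.
Qed.

(** Orienting the source edge upwards costs nothing, since a reversed source
    can be paired with a reversed target; the target then has two genuinely
    different orientations, the downward one requiring complementation. *)
Lemma bkneser_aut_of_flag n k (u v x y : bipartite_kneser n k) :
  k <= n - k -> k <= n -> adj u v -> adj x y -> val u \subset val v ->
  exists2 q : {perm bipartite_kneser n k},
    q \in graph_aut (bipartite_kneser n k) & q u = x /\ q v = y.
Proof.
move=> le_k le_kn uv xy s_uv.
have [cu cv] := bkneser_adj_card le_k uv s_uv.
case/andP: (xy) => _ /orP[s_xy | s_yx].
- have [cx cy] := bkneser_adj_card le_k xy s_xy.
  have [||p [pu pv]] := exists_perm_flag s_uv s_xy; rewrite ?cu ?cv //.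
  have p_inj := @perm_inj _ p.
  have [|A|A B|q q_aut qE] := @bkneser_aut_lift n k (fun A : {set 'I_n} => p @: A).
  + exact: imset_inj.
  + by rewrite card_imset.
  + by rewrite !subset_perm_imset.
  by exists q => //; split; apply: val_inj; rewrite qE.
- rewrite adj_sym in xy.
  have [cy cx] := bkneser_adj_card le_k xy s_yx.
  have s_cxy : ~: val x \subset ~: val y by rewrite setCS.
  have cardC (A : {set 'I_n}) : #|~: A| = n - #|A|.
    by rewrite cardsCs setCK card_ord.
  have [||p [pu pv]] := exists_perm_flag s_uv s_cxy;
    rewrite ?cardC ?cu ?cv ?cx ?cy ?subKn //.
  have p_inj := @perm_inj _ p.
  have [|A|A B|q q_aut qE] := @bkneser_aut_lift n k (fun A : {set 'I_n} => ~: (p @: A)).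
  + by move=> A B /setC_inj /(imset_inj p_inj).
  + by rewrite cardC card_imset // => /orP[] /eqP->; rewrite ?subKn ?eqxx ?orbT.
  + by rewrite !setCS !subset_perm_imset orbC.
  by exists q => //; split; apply: val_inj; rewrite qE ?pu ?pv setCK.
Qed.

Theorem theorem3p2 (n k : nat) (hk : 1 <= k) (hn : 2 * k + 1 <= n) :
  arc_transitive (bipartite_kneser n k).
Proof.
have le_kk : k + k <= n by rewrite addnn -mul2n (leq_trans _ hn) // leq_addr.
have le_kn : k <= n by apply: leq_trans le_kk; apply: leq_addr.
have le_k : k <= n - k by rewrite leq_subRL.
move=> u v x y uv xy; case/andP: (uv) => _ /orP[s_uv | s_vu].
  exact: bkneser_aut_of_flag.
have [|||q q_aut [qv qu]] := @bkneser_aut_of_flag n k v u y x le_k le_kn.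
- by rewrite adj_sym.
- by rewrite adj_sym.
- by [].
by exists q.
Qed.
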